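(* Let $X$ be a Banach space and let $G\subseteq\mathcal{L}(X)$ be a compact topological group of isometries acting on $X$. If $A,B\subseteq X$ are nonempty, convex and $G$-invariant sets such that $A$ is closed, $B$ is compact and $A\cap B=\emptyset$, then there exists a $G$-invariant hyperplane that strictly separates $A$ and $B$.
   Context: $\mathcal{L}(X)$ is the space of continuous linear maps $X\to X$ with the operator norm topology; $G\subseteq \mathcal{L}(X)$ is a group (under composition) of invertible bounded linear maps with the relative topology. Functionals are real-valued. A set $K\subseteq X$ is $G$-invariant if $g(K)=K$ for every $g\in G$. An (affine) hyperplane is a set $H=\{x\in X\mid f(x)=\alpha\}$ with $f$ a nonzero linear functional and $\alpha\in\mathbb{R}$. It strictly separates $A$ and $B$ if there is $\epsilon>0$ such that $f(x)\le\alpha-\epsilon$ for all $x\in A$ and $f(x)\ge\alpha+\epsilon$ for all $x\in B$. *)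

(* Defs.v *)
(* MathComp-Analysis *)
From HB Require Import structures.
From mathcomp Require Import all_boot all_order all_algebra.
From mathcomp Require Import all_classical all_reals all_analysis.
Import Order.TTheory GRing.Theory Num.Theory.
Import numFieldNormedType.Exports.

Set Implicit Arguments.
Unset Strict Implicit.
Unset Printing Implicit Defensive.

Local Open Scope classical_set_scope.
Local Open Scope ring_scope.

Section BoundedOperators.
Variables (R : realType) (X : normedModType R).

Definition bounded_op_pred : {pred X -> X} :=
  [pred f : X -> X | `[< linear f /\ continuous f >]].

(* The space L(X) of continuous linear maps X -> X. *)
Record bounded_op := BoundedOp {
  bounded_op_fun :> X -> X;
  bounded_op_subproof : bounded_op_fun \in bounded_op_pred }.

HB.instance Definition _ := [isSub for bounded_op_fun].
HB.instance Definition _ := gen_eqMixin bounded_op.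
HB.instance Definition _ := gen_choiceMixin bounded_op.

Lemma bounded_opP (f : X -> X) :
  reflect (linear f /\ continuous f) (f \in bounded_op_pred).
Proof. by rewrite inE; apply: asboolP. Qed.

Lemma bounded_op_linear (f : bounded_op) : linear f.
Proof. by case: (bounded_opP f (bounded_op_subproof f)). Qed.

Lemma bounded_op_continuous (f : bounded_op) : continuous f.
Proof. by case: (bounded_opP f (bounded_op_subproof f)). Qed.

HB.instance Definition _ (f : bounded_op) :=
  GRing.isLinear.Build R X X *:%R f (bounded_op_linear f).

Lemma bounded_op_submod_closed : submod_closed bounded_op_pred.
Proof.
split=> [|a f g /bounded_opP[lf cf] /bounded_opP[lg cg]]; apply/bounded_opP.
  by split; [move=> a x y /=; rewrite scaler0 addr0|
             exact: cst_continuous].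
split=> [b x y|x].
  rewrite !addrfctE !scalrfctE lf lg !scalerDr !scalerA [a * b]mulrC.
  by rewrite addrACA.
have -> : a *: f + g = fun y => a *: f y + g y by [].
by apply: cvgD; [apply: cvgZl_tmp; exact: cf|exact: cg].
Qed.

HB.instance Definition _ :=
  GRing.isSubmodClosed.Build R (X -> X) bounded_op_pred
    bounded_op_submod_closed.
HB.instance Definition _ := [SubChoice_isSubLmodule of bounded_op by <:].

Definition op_norm (f : bounded_op) : R :=
  sup [set `|f x| | x in [set x : X | `|x| <= 1]].

Lemma op_norm_has_sup (f : bounded_op) :
  has_sup [set `|f x| | x in [set x : X | `|x| <= 1]].
Proof.
split; first by exists `|f 0|, 0 => //=; rewrite normr0.
have /bounded_funP/(_ 1)[M fM] : bounded_near f (nbhs (0 : X)).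
  exact/linear_bounded_continuous/bounded_op_continuous.
by exists M => _ [x x1 <-]; exact: fM.
Qed.

Lemma op_norm_unit (f : bounded_op) (x : X) : `|x| <= 1 -> `|f x| <= op_norm f.
Proof.
by move=> x1; apply: sup_ubound; [case: (op_norm_has_sup f)|exists x].
Qed.

Lemma op_norm_le (f : bounded_op) (M : R) :
  (forall x, `|x| <= 1 -> `|f x| <= M) -> op_norm f <= M.
Proof.
move=> fM; apply: ge_sup; first by case: (op_norm_has_sup f).
by move=> _ [x x1 <-]; exact: fM.
Qed.

Lemma op_norm_ge0 (f : bounded_op) : 0 <= op_norm f.
Proof. by apply: le_trans (op_norm_unit f (x := 0) _); rewrite ?normr0. Qed.

Lemma ler_op_norm (f : bounded_op) (x : X) : `|f x| <= op_norm f * `|x|.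
Proof.
have [->|x0] := eqVneq x 0; first by rewrite linear0 !normr0 mulr0.
have nx : 0 < `|x| by rewrite normr_gt0.
have := op_norm_unit f (x := `|x|^-1 *: x).
rewrite linearZ/= !normrZ normfV normr_id mulVf ?gt_eqF// => /(_ (lexx _)).
by rewrite mulrC ler_pdivrMr.
Qed.

Lemma op_normD (f g : bounded_op) : op_norm (f + g) <= op_norm f + op_norm g.
Proof.
apply: op_norm_le => x x1; apply: le_trans (ler_normD _ _) _.
by apply: lerD; exact: op_norm_unit.
Qed.

Lemma op_normZ_le (a : R) (f : bounded_op) :
  op_norm (a *: f) <= `|a| * op_norm f.
Proof.
apply: op_norm_le => x x1; rewrite [leLHS]normrZ.
by apply: ler_wpM2l => //; exact: op_norm_unit.
Qed.

Lemma op_norm_eq0 (f : bounded_op) : op_norm f = 0 -> f = 0.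
Proof.
move=> f0; apply/val_inj/funext => x; apply/eqP.
by rewrite -normr_le0; have := ler_op_norm f x; rewrite f0 mul0r.
Qed.

Lemma op_normZ (a : R) (f : bounded_op) : op_norm (a *: f) = `|a| * op_norm f.
Proof.
apply/eqP; rewrite eq_le op_normZ_le/=.
have [->|a0] := eqVneq a 0; first by rewrite normr0 mul0r op_norm_ge0.
rewrite -ler_pdivlMl ?normr_gt0// -normfV.
by rewrite -{1}[f](scalerK a0) op_normZ_le.
Qed.

(* Equips L(X) with the operator norm and with the topology it induces. *)
HB.instance Definition _ :=
  Lmodule_isNormed.Build R bounded_op op_normD op_normZ op_norm_eq0.

Lemma op_id_subproof : (@idfun X) \in bounded_op_pred.
Proof. by apply/bounded_opP; split=> // x; exact: cvg_id. Qed.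

Definition op_id : bounded_op := BoundedOp op_id_subproof.

Lemma op_comp_subproof (f g : bounded_op) : f \o g \in bounded_op_pred.
Proof.
apply/bounded_opP; split=> [a x y|x]; first by rewrite /= !linearP.
by apply: continuous_comp; exact: bounded_op_continuous.
Qed.

Definition op_comp (f g : bounded_op) : bounded_op :=
  BoundedOp (op_comp_subproof f g).

(* Continuity of composition and inversion on G is automatic for the operator
   norm, so G with the relative topology is a topological group. *)
Definition op_group (G : set bounded_op) : Prop :=
  [/\ G op_id,
      forall g h, G g -> G h -> G (op_comp g h) &
      forall g, G g ->
        exists2 h, G h & op_comp g h = op_id /\ op_comp h g = op_id].

Definition op_isometry (g : bounded_op) : Prop :=
  forall x y, `|g x - g y| = `|x - y|.

Definition invariant_set (G : set bounded_op) (K : set X) : Prop :=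
  forall g, G g -> g @` K = K.

(* The functional f need not be continuous, so the hyperplane need not be
   closed; that f is nonzero is left as a separate hypothesis. *)
Definition hyperplane (f : {scalar X}) (alpha : R) : set X :=
  [set x | f x = alpha].

Definition strictly_separates (f : {scalar X}) (alpha : R) (A B : set X) :
    Prop :=
  exists2 e : R, 0 < e &
    (forall x, A x -> f x <= alpha - e) /\ (forall x, B x -> alpha + e <= f x).

End BoundedOperators.

(* Main.v *)
(* The averages over G needed here are obtained without Haar measure. Let S be
   the mean of the elements of a finite e-net (s_i) of G. For g, h in G some
   s_j h is e-close to s_0 g, so in the difference of the two sums making up T
   S g x and T S h x one of the #|I| terms is of order e and the others are
   bounded by the oscillation of T along the orbit of x. Hence the oscillation
   of S^k decays geometrically to about e, while S^k is a contraction which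
   preserves every convex G-invariant set.
   Let N be the space of vectors which such averages send near 0; it contains
   all g x - x. Averaging shows that b - a + n has norm at least r = dist(A, B)
   for a in A, b in B and n in N. By Hahn-Banach, some linear f vanishes on N
   and satisfies f b - f a >= r. *)
Require Import Defs.
From HB Require Import structures.
From mathcomp Require Import all_boot all_order all_algebra perm.
From mathcomp Require Import all_classical all_reals all_analysis.
From mathcomp Require Import finmap ring lra.
Import Order.TTheory GRing.Theory Num.Theory.
Import numFieldNormedType.Exports.
Set Implicit Arguments.
Unset Strict Implicit.
Unset Printing Implicit Defensive.
Local Open Scope classical_set_scope.
Local Open Scope ring_scope.

(** * The Hahn-Banach theorem for sublinear functionals *)

Section HahnBanach.
Context {R : realType} {E : lmodType R}.
Implicit Types (p q : E -> R) (K : set (E * R)).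

Definition sublinear p :=
  (forall x y, p (x + y) <= p x + p y) /\
  (forall t x, 0 <= t -> p (t *: x) <= t * p x).

Definition convex_cone K :=
  [/\ K (0, 0), forall u v, K u -> K v -> K (u + v) &
      forall (t : R) u, 0 <= t -> K u -> K (t *: u.1, t * u.2)].

Lemma sublinear0 p : sublinear p -> p 0 = 0.
Proof.
move=> [pD pZ]; have := pZ 0 0 (lexx _); have := pD 0 0.
rewrite scale0r mul0r addr0 => ? ?; lra.
Qed.

Lemma sublinear_ge p x y : sublinear p -> p y - p (- x) <= p (x + y).
Proof.
by move=> [pD _]; rewrite lerBlDr; have := pD (x + y) (- x); rewrite addrC addKr.
Qed.

(* Lowering a sublinear functional by a cone of constraints: the result
   takes a value <= - s at - y for every (y, s) in K. *)
Definition cone_inf p K (x : E) : R := inf [set p (x + u.1) - u.2 | u in K].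

(** The bound [u.2 <= p u.1] on [K] keeps every term above [- p (- x)], so the infimum is finite.
    Closure of [K] under sums and nonnegative scaling carries sublinearity over from [p]. *)
Lemma cone_infP p K : sublinear p -> convex_cone K ->
    (forall u, K u -> u.2 <= p u.1) ->
  sublinear (cone_inf p K) /\
  (forall x u, K u -> cone_inf p K x <= p (x + u.1) - u.2).
Proof.
move=> sp [K0 KD KZ] Kp.
have lb x u : K u -> cone_inf p K x <= p (x + u.1) - u.2.
  move=> Ku; apply: ge_inf; last by exists u.
  exists (- p (- x)) => _ [v /Kp Kv <-].
  by have := sublinear_ge x v.1 sp; lra.
have glb x (c : R) : (forall u, K u -> c <= p (x + u.1) - u.2) -> c <= cone_inf p K x.
  move=> cK; apply: lb_le_inf; last by move=> _ [u /cK + <-].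
  by exists (p (x + 0) - 0), (0, 0).
split => //; split=> [x y|t x t0].
  rewrite -lerBlDr; apply: (@glb) => u Ku; rewrite lerBlDr -lerBlDl.
  apply: (@glb) => v Kv; have := lb (x + y) _ (KD _ _ Ku Kv).
  have := sp.1 (x + u.1) (y + v.1).
  by rewrite addrACA /=; lra.
have [->|tn0] := eqVneq t 0.
  by have := lb 0 _ K0; rewrite scale0r mul0r /= addr0 (sublinear0 sp) subr0.
have tp : 0 < t by rewrite lt_neqAle eq_sym tn0.
rewrite -ler_pdivrMl//; apply: (@glb) => u Ku; rewrite ler_pdivrMl//.
apply: le_trans (lb _ _ (KZ _ _ t0 Ku)) _.
by rewrite /= -scalerDr mulrBr lerB// sp.2.
Qed.

(** Lowering [p] by the ray through [(y, p y)] gives a sublinear functional below [p], which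
    minimality forces to equal [p]; its bound at [(y, p y)] then reads [p x <= p (x + y) - p y]. *)
Lemma minimal_sublinear_scalar p : sublinear p ->
  (forall q, sublinear q -> (forall x, q x <= p x) -> forall x, p x <= q x) ->
  scalar p.
Proof.
move=> sp pmin.
have pD y x : p (x + y) = p x + p y.
  apply/eqP; rewrite eq_le sp.1/=.
  pose K := [set u : E * R | exists2 t, 0 <= t & u = (t *: y, t * p y)].
  have K0 : K (0, 0) by exists 0; rewrite ?scale0r ?mul0r.
  have [|u [t t0 ->]|sq qK] := @cone_infP p K sp.
  - split=> // [_ _ [s s0 ->] [t t0 ->]|s _ s0 [t t0 ->]].
      by exists (s + t); rewrite ?addr_ge0// scalerDl mulrDl.
    by exists (s * t); rewrite ?mulr_ge0//= scalerA mulrA.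
  - rewrite /=; have [->|tn0] := eqVneq t 0.
      by rewrite mul0r scale0r sublinear0.
    have tp : 0 < t by rewrite lt_neqAle eq_sym tn0.
    rewrite -ler_pdivlMl//; apply: le_trans (sp.2 _ _ _); last by rewrite invr_ge0.
    by rewrite scalerK.
  - have Ky : K (y, p y) by exists 1; rewrite ?scale1r ?mul1r.
    rewrite -lerBrDr; apply: le_trans (qK _ _ Ky) => /=.
    apply: pmin => // z.
    by have := qK z _ K0; rewrite /= addr0 subr0.
have pN x : p (- x) = - p x.
  by apply/eqP; rewrite -addr_eq0 -pD addNr sublinear0.
have pZ t x : 0 <= t -> p (t *: x) = t * p x.
  move=> t0; apply/eqP; rewrite eq_le sp.2//= -lerN2 -pN -scalerN.
  by apply: le_trans (sp.2 _ _ t0) _; rewrite pN mulrN.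
move=> a x y; rewrite pD; congr (_ + _).
have [a0|a0] := leP 0 a; first exact: pZ.
rewrite -{1}[a]opprK scaleNr pN pZ ?oppr_ge0; last exact: ltW.
by rewrite mulNr opprK.
Qed.

Theorem hahn_banach q : sublinear q ->
  exists f : {scalar E}, forall x, f x <= q x.
Proof.
move=> sq.
pose T := {p | sublinear p /\ forall x, p x <= q x}.
(* The order is reversed, so that Zorn's lemma yields a minimal functional. *)
pose r (s t : T) := `[< forall x, sval t x <= sval s x >].
(* A lower bound common to all of [T], which keeps the infimum of a chain finite. *)
have tge (s : T) x : - q (- x) <= sval s x.
  case: s => s [ss sle] /=; have := sublinear_ge x 0 ss; have := sle (- x).
  by rewrite addr0 sublinear0//; lra.
have [|||[p [sp ple]] pmax] := @ZL_preorder T (exist _ q (conj sq (fun=> lexx _))) r.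
- by move=> t; apply/asboolP => x.
- move=> s t u /asboolP st /asboolP tu; apply/asboolP => x.
  exact: le_trans (tu x) (st x).
- move=> A Atot; have [[t0 At0]|A0] := pselect (A !=set0); last first.
    exists (exist _ q (conj sq (fun=> lexx _))) => s As; exfalso.
    by apply: A0; exists s.
  pose m x := inf [set sval s x | s in A].
  have lb s x : A s -> m x <= sval s x.
    move=> As; apply: ge_inf; last by exists s.
    by exists (- q (- x)) => _ [u _ <-].
  have glb x (c : R) : (forall s, A s -> c <= sval s x) -> c <= m x.
    move=> cA; apply: lb_le_inf; first by exists (sval t0 x), t0.
    by move=> _ [s /cA + <-].
  have sm : sublinear m.
    split=> [x y|t x t_ge0].
      rewrite -lerBlDr; apply: (@glb) => s As; rewrite lerBlDr -lerBlDl.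
      apply: (@glb) => u Au; rewrite lerBlDl.
      (* The smaller of [s] and [u], which are comparable in the chain, bounds [m] at [x + y] and is
         subadditive there. *)
      case: (Atot s u As Au) => /asboolP su.
        apply: le_trans (lb _ _ Au) _; apply: le_trans ((svalP u).1.1 _ _) _.
        by rewrite lerD2r.
      apply: le_trans (lb _ _ As) _; apply: le_trans ((svalP s).1.1 _ _) _.
      by rewrite lerD2l.
    have [->|tn0] := eqVneq t 0.
      rewrite scale0r mul0r; apply: le_trans (lb _ _ At0) _.
      by rewrite sublinear0//; exact: (svalP t0).1.
    have tp : 0 < t by rewrite lt_neqAle eq_sym tn0.
    rewrite -ler_pdivrMl//; apply: (@glb) => s As; rewrite ler_pdivrMl//.
    by apply: le_trans (lb _ _ As) _; exact: (svalP s).1.2.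
  have mq x : m x <= q x by exact: le_trans (lb _ _ At0) ((svalP t0).2 x).
  by exists (exist _ m (conj sm mq)) => s As; apply/asboolP => x; exact: lb.
have plin : scalar p.
  apply: minimal_sublinear_scalar => // s ss sp_le.
  have sq_le x : s x <= q x by exact: le_trans (sp_le x) (ple x).
  by have /asboolP := pmax (exist _ s (conj ss sq_le)) (introT (asboolP _) sp_le).
pose fL := GRing.isLinear.Build R E R *%R p plin.
pose f : {scalar E} := HB.pack p fL.
by exists f.
Qed.

End HahnBanach.

(** * Convex combinations and means *)

Section Convexity.
Context {R : realType} {E : lmodType R}.
Implicit Type C : set E.

(** Leaving the weights unnormalised serves both the induction for means and addition in the cone of
    constraints. If [s + t = 0], both weights vanish and any point will do. *)
Lemma convex_set_combine C (s t : R) x y : convex_set C -> C x -> C y ->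
  0 <= s -> 0 <= t -> exists2 z, C z & s *: x + t *: y = (s + t) *: z.
Proof.
move=> cC Cx Cy s0 t0; have [st0|st0] := eqVneq (s + t) 0.
  exists x => //; move/eqP: (st0); rewrite paddr_eq0// => /andP[/eqP -> /eqP ->].
  by rewrite addr0 !scale0r addr0.
have stp : 0 < s + t by rewrite lt_neqAle eq_sym st0 addr_ge0.
have l0 : 0 <= s / (s + t) by rewrite divr_ge0// ltW.
have l1 : s / (s + t) <= 1 by rewrite ler_pdivrMr// mul1r lerDl.
have l01 : Itv.spec (Itv.num_sem (R := R)) (Itv.Real `[0%Z, 1%Z]) (s / (s + t)).
  by rewrite /= /Itv.num_sem/= num_real /= in_itv/= l0 l1.
pose l : {i01 R} := Itv.mk l01.
have /set_mem Cz := cC x y l (mem_set Cx) (mem_set Cy).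
exists (l%:num *: x + (1 - l%:num) *: y) => //=.
rewrite scalerDr !scalerA mulrBr mulr1 mulrCA divff// mulr1.
by rewrite addrAC subrr add0r.
Qed.

Lemma convex_set_mean C (I : finType) (F : I -> E) : convex_set C ->
  (0 < #|I|)%N -> (forall i, C (F i)) -> C (#|I|%:R^-1 *: \sum_i F i).
Proof.
move=> cC I0 CF.
(* Clearing the denominator lets the induction add one summand at a time, with weights 1 and the
   length of the tail. *)
suff [z Cz ->] : exists2 z, C z & \sum_i F i = #|I|%:R *: z.
  by rewrite scalerK// pnatr_eq0 -lt0n.
rewrite -big_enum cardE; move: I0; rewrite cardE.
elim: (enum I) => [//|i s IH] _; rewrite big_cons /=.
case: s IH => [|j s] IH; first by exists (F i); rewrite // big_nil addr0 scale1r.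
have [//|z Cz ->] := IH.
have [w Cw] := convex_set_combine cC (CF i) Cz ler01 (ler0n _ (size (j :: s))).
by rewrite scale1r => ->; exists w; rewrite // -natr1 addrC.
Qed.

End Convexity.

(** * Almost invariant averages over a compact group *)

Section Averaging.
Context {R : realType} {X : normedModType R}.
Implicit Types (G : set (bounded_op X)) (T g h : bounded_op X) (x y : X).

Lemma op_norm_isometry g x : op_isometry g -> `|g x| = `|x|.
Proof. by move=> /(_ x 0); rewrite linear0 !subr0. Qed.

Lemma compact_finite_net G (e : R) : compact G -> G !=set0 -> 0 < e ->
  exists (I : finType) (s : I -> bounded_op X),
    [/\ (0 < #|I|)%N, forall i, G (s i) &
        forall g, G g -> exists i, forall x, `|s i x - g x| <= e * `|x|].
Proof.
rewrite compact_cover => cG [g0 Gg0] e0.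
have [||D DG GD] := cG _ G (fun g => ball g e).
- by move=> g _; exact: ball_open.
- by move=> g Gg; exists g => //; exact: ballxx.
exists (fset_sub_type D), (fun i => fsval i); split.
- have [i iD _] := GD _ Gg0; by apply/card_gt0P; exists [` iD]%fset.
- by move=> i; exact/set_mem/DG/fsvalP.
move=> g Gg; have [i iD] := GD _ Gg; rewrite /= -ball_normE /= => ig.
exists [` iD]%fset => x /=; apply: le_trans (ler_op_norm (i - g) x) _.
by rewrite ler_wpM2r// ltW.
Qed.

Definition mean_op (I : finType) (s : I -> bounded_op X) : bounded_op X :=
  #|I|%:R^-1 *: \sum_i s i.

Lemma mean_opE (I : finType) (s : I -> bounded_op X) x :
  mean_op s x = #|I|%:R^-1 *: \sum_i s i x.
Proof.
rewrite /mean_op; congr (_ *: _).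
by elim/big_ind2 : _ => // f a h b <- <-.
Qed.

(* A stand-in for membership in the convex hull of G. *)
Definition averaging G T :=
  (forall x, `|T x| <= `|x|) /\
  (forall C : set X, convex_set C -> invariant_set G C -> forall x, C x -> C (T x)).

Lemma averaging_id G : averaging G (op_id X).
Proof. by split. Qed.

Lemma averaging_comp G S T : averaging G S -> averaging G T ->
  averaging G (op_comp S T).
Proof.
move=> [S1 SC] [T1 TC]; split=> [x|C cC iC x Cx] /=.
  exact: le_trans (S1 _) (T1 _).
by apply: SC => //; exact: TC.
Qed.

Lemma averaging_mean G (I : finType) (s : I -> bounded_op X) :
  (forall g, G g -> op_isometry g) -> (0 < #|I|)%N -> (forall i, G (s i)) ->
  averaging G (mean_op s).
Proof.
move=> isoG I0 sG; split=> [x|C cC iC x Cx]; rewrite mean_opE; last first.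
  apply: convex_set_mean => // i; rewrite -(iC _ (sG i)); by exists x.
have Ip : 0 < #|I|%:R :> R by rewrite ltr0n.
rewrite normrZ gtr0_norm ?invr_gt0// ler_pdivrMl//.
apply: le_trans (ler_norm_sum _ _ _) _.
rewrite (eq_bigr (fun=> `|x|)) => [|i _]; last exact/op_norm_isometry/isoG.
by rewrite sumr_const cardT -cardE mulr_natl.
Qed.

(** Swapping [i] and [j] in the second sum pairs [a i] with [b j], which costs at most [e]; each of
    the other [#|I| - 1] pairs costs at most [d]. *)
Lemma ler_norm_sumB_pair (I : finType) (a b : I -> X) (d e : R) (i j : I) :
  (forall k l, `|a k - b l| <= d) -> `|a i - b j| <= e ->
  `|\sum_k a k - \sum_k b k| <= e + (#|I|%:R - 1) * d.
Proof.
move=> abd abe; rewrite [\sum_k b k](reindex_perm (tperm i j)) /= -sumrB.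
apply: le_trans (ler_norm_sum _ _ _) _.
rewrite (bigD1 i)//= tpermL lerD//.
apply: le_trans (ler_sum _ (fun k _ => abd k _)) _.
rewrite sumr_const (eq_card (B := predC1 i))// cardC1 -[leLHS]mulr_natl -subn1.
by rewrite natrB//; apply/card_gt0P; exists i.
Qed.

Lemma averaging_almost_invariant G (delta : R) : op_group G -> compact G ->
  (forall g, G g -> op_isometry g) -> 0 < delta ->
  exists2 T, averaging G T &
    forall g x, G g -> `|T (g x) - T x| <= delta * `|x|.
Proof.
move=> [G1 GM GV] cG isoG delta0.
(* Half of [delta] is for the net, the other half for the decaying term. *)
pose e := delta / 2; have e0 : 0 < e by rewrite divr_gt0.
have [|I [s [I0 sG sN]]] := compact_finite_net cG _ e0; first by exists (op_id X).
have n0 : 0 < #|I|%:R :> R by rewrite ltr0n.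
have n1 : 1 <= #|I|%:R :> R by rewrite ler1n.
(* With n = [#|I|], an oscillation bound d becomes (e + (n - 1) d) / n at each step; this map has
   fixed point [e] and ratio [c]. *)
pose c : R := 1 - #|I|%:R^-1.
have c0 : 0 <= c by rewrite subr_ge0 invf_le1.
have c1 : c < 1 by rewrite ltrBlDr ltrDl invr_gt0.
(* Each new mean acts first, so [T k.+1 (g x)] is a mean of the values [T k (s i (g x))], and the
   bound for [T k] applies to them. *)
pose T k := iter k (fun T => op_comp T (mean_op s)) (op_id X).
have TS k y : T k.+1 y = T k (mean_op s y) by [].
have Tav k : averaging G (T k).
  elim: k => [|k IH]; first exact: averaging_id.
  by apply: averaging_comp => //; exact: averaging_mean.
have Tosc k g h x : G g -> G h ->
    `|T k (g x) - T k (h x)| <= (e + c ^+ k * 2) * `|x|.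
  elim: k g h x => [|k IH] g h x Gg Gh.
    rewrite expr0 mul1r /=; apply: le_trans (ler_normB _ _) _.
    rewrite !op_norm_isometry; [|exact: isoG..].
    by rewrite mulrDl mulr_natl -mulr2n lerDr mulr_ge0// ltW.
  rewrite !TS !mean_opE -linearB -scalerBr linearZ /= normrZ gtr0_norm ?invr_gt0//.
  rewrite linearB /= !(linear_sum (T k)) /= ler_pdivrMl//.
  have [i _] := card_gt0P I0.
  (* With [h'] the inverse of [h], the net point [s j] approximates [s i] after [g] after [h'];
     evaluation at [h x] brings [s j (h x)] close to [s i (g x)]. *)
  have [h' Gh' [_ hh]] := GV h Gh.
  have [j sj] := sN _ (GM _ _ (GM _ _ (sG i) Gg) Gh').
  apply: le_trans (@ler_norm_sumB_pair _ (fun i => T k (s i (g x)))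
    (fun i => T k (s i (h x))) ((e + c ^+ k * 2) * `|x|) (e * `|x|) i j _ _) _.
  - by move=> l m; apply: (IH (op_comp (s l) g) (op_comp (s m) h)); apply: GM.
  - rewrite -linearB; apply: le_trans ((Tav k).1 _) _; rewrite distrC.
    have := sj (h x); rewrite (op_norm_isometry x (isoG _ Gh)) /=.
    by have /(congr1 (fun f : bounded_op X => f x)) /= -> := hh.
  rewrite !mulrA -mulrDl ler_wpM2r// exprS /c.
  rewrite le_eqVlt; apply/orP; left; apply/eqP; field.
  by rewrite gt_eqF.
have [k ck] : exists k, c ^+ k * 2 <= e.
  have /cvgrPdist_le/(_ (e / 2)) : (fun k => c ^+ k) @ \oo --> 0.
    by apply: cvg_expr; rewrite ger0_norm.
  case; first by rewrite divr_gt0.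
  move=> k _ /(_ k (leqnn k)) /=; rewrite sub0r normrN ger0_norm ?exprn_ge0//.
  by rewrite ler_pdivlMr// => ?; exists k.
exists (T k) => // g x Gg; apply: le_trans (Tosc k g (op_id X) x Gg G1) _.
by rewrite ler_wpM2r// [leRHS]splitr lerD2l.
Qed.

End Averaging.

(** * Separation by an invariant functional *)

Lemma closed_compact_gap (R : realType) (X : normedModType R) (A B : set X) :
  closed A -> compact B -> A `&` B = set0 ->
  exists2 r : R, 0 < r & forall a b, A a -> B b -> r <= `|b - a|.
Proof.
move=> clA /compact_near_coveringP cB AB0.
pose P (r : R) (b : X) := forall a, A a -> r <= `|b - a|.
have : \forall r \near 0^'+, B `<=` P r.
  apply: (cB _ _ P) => b Bb.
  have /nbhs_ballP[e /= e0 eA] : nbhs b (~` A).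
    apply: open_nbhs_nbhs; split; first exact: closed_openC.
    by move=> Ab; have : (A `&` B) b by []; rewrite AB0.
  (* Points within [e / 2] of [b] stay at distance at least [e / 2] from [A]; compactness of [B]
     then makes one [r] serve everywhere. *)
  have e20 : 0 < e / 2 by rewrite divr_gt0.
  near=> b' r => a Aa.
  have bb' : `|b - b'| < e / 2.
    by near: b'; exact: (@cvgr_dist_lt _ _ _ (nbhs b)).
  have re : r <= e / 2 by near: r; exact: nbhs_right_le.
  have : e <= `|b - a|.
    rewrite leNgt; apply/negP => ba; apply: (eA a) => //.
    by rewrite -ball_normE.
  by have := ler_distD b' b a; rewrite /=; lra.
move=> rB; near (0 : R)^'+ => r.
exists r => // a b Aa Bb; move: a Aa; have : P r b; last exact.
by move: b Bb; near: r.
Unshelve. all: by end_near. Qed.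

Section Separation.
Context {R : realType} {X : normedModType R}.
Implicit Types (G : set (bounded_op X)) (T g : bounded_op X) (x y n : X).

Definition almost_invariant G (delta : R) T := [/\ 0 < delta, averaging G T &
  forall g x, G g -> `|T (g x) - T x| <= delta * `|x|].

(* A stand-in for the closed span of the vectors g x - x. *)
Definition negligible G n := exists2 M : R, 0 <= M &
  forall delta T, almost_invariant G delta T -> `|T n| <= delta * M.

Lemma negligible_sub G g x : G g -> negligible G (g x - x).
Proof. by move=> Gg; exists `|x| => // d T [_ _ iT]; rewrite linearB; exact: iT. Qed.

Lemma negligible0 G : negligible G 0.
Proof. by exists 0 => // d T _; rewrite linear0 normr0 mulr0. Qed.

Lemma negligibleD G m n : negligible G m -> negligible G n ->
  negligible G (m + n).
Proof.
move=> [M M0 mM] [N N0 nN]; exists (M + N); rewrite ?addr_ge0// => d T iT.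
by rewrite linearD mulrDr (le_trans (ler_normD _ _))// lerD ?mM ?nN.
Qed.

Lemma negligibleZ G (a : R) n : negligible G n -> negligible G (a *: n).
Proof.
move=> [N N0 nN]; exists (`|a| * N); rewrite ?mulr_ge0// => d T iT.
by rewrite linearZ normrZ mulrCA ler_wpM2l// nN.
Qed.

Lemma norm_sublinear : sublinear (fun x : X => `|x|).
Proof.
by split=> [x y|t x t0]; rewrite ?ler_normD// normrZ ger0_norm.
Qed.

Lemma invariant_separation G (A B : set X) (r : R) :
  op_group G -> compact G -> (forall g, G g -> op_isometry g) ->
  A !=set0 -> B !=set0 -> convex_set A -> convex_set B ->
  invariant_set G A -> invariant_set G B ->
  (forall a b, A a -> B b -> r <= `|b - a|) ->
  exists2 f : {scalar X}, forall g x, G g -> f (g x) = f x &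
    forall a b, A a -> B b -> f a + r <= f b.
Proof.
move=> Ggrp cG isoG [a0 Aa0] [b0 Bb0] cA cB iA iB rAB.
(* [K] holds the lower bounds wanted for [f]: [r] on the differences [b - a] and 0 on negligible
   vectors, closed up into a cone. *)
pose K := [set u : X * R | exists t a b n,
  [/\ 0 <= t, A a, B b, negligible G n & u = (t *: (b - a) + n, t * r)]].
have K0 n : negligible G n -> K (n, 0).
  by exists 0, a0, b0, n; rewrite scale0r add0r mul0r.
have coneK : convex_cone K.
  split.
  - by apply: K0; exact: negligible0.
  - move=> _ _ [s [a [b [m [s0 Aa Bb Nm ->]]]]] [t [a' [b' [n [t0 Aa' Bb' Nn ->]]]]].
    have [a'' Aa'' ea] := convex_set_combine cA Aa Aa' s0 t0.
    have [b'' Bb'' eb] := convex_set_combine cB Bb Bb' s0 t0.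
    exists (s + t), a'', b'', (m + n); split; rewrite ?addr_ge0//.
      exact: negligibleD.
    rewrite [(s + t) *: _]scalerBr -ea -eb !scalerBr mulrDl; congr pair.
    by rewrite opprD addrACA; congr (_ + _); rewrite addrACA.
  - move=> t _ t0 [s [a [b [n [s0 Aa Bb Nn ->]]]]].
    exists (t * s), a, b, (t *: n); split; rewrite ?mulr_ge0//=.
      exact: negligibleZ.
    by rewrite scalerDr scalerA mulrA.
have Kle u : K u -> u.2 <= `|u.1|.
  move=> [t [a [b [n [t0 Aa Bb [M M0 nM] ->]]]]] /=.
  apply/ler_addgt0Pr => e e0.
  (* The denominator [M + 1] is positive even for [M = 0], and [d * M <= e]. *)
  pose d := e / (M + 1).
  have d0 : 0 < d by rewrite divr_gt0// ltr_wpDl.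
  have [T avT iT] := averaging_almost_invariant Ggrp cG isoG d0.
  have TAB : r <= `|T b - T a| by apply: rAB; [exact: avT.2|exact: avT.2].
  have Tn : `|T n| <= e.
    apply: le_trans (nM d T _) _; first by split.
    by rewrite /d mulrAC ler_pdivrMr ?ltr_wpDl// ler_wpM2l// ?lerDl// ltW.
  (* [T] does not increase norms and sends [b - a] to another difference of points of [B] and [A],
     of norm at least [r]; the term [T n] costs at most [e]. *)
  apply: le_trans (_ : `|T (t *: (b - a) + n)| + `|T n| <= _); last first.
    by rewrite lerD// avT.1.
  rewrite linearD linearZ /= linearB /=.
  apply: le_trans (ler_wpM2l t0 TAB) _.
  rewrite -[t in t * _]ger0_norm// -normrZ.
  by rewrite -[in leLHS](addrK (T n) (t *: (T b - T a))); exact: ler_normB.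
have [sq qK] := cone_infP norm_sublinear coneK Kle.
have [f fq] := hahn_banach sq.
(* At [- u.1] the norm in the infimum vanishes, and the upper bound on [f] there turns into a lower
   bound on [f u.1]. *)
have fK u : K u -> f u.1 >= u.2.
  move=> Ku; have := le_trans (fq (- u.1)) (qK (- u.1) _ Ku).
  by rewrite addNr normr0 sub0r linearN lerN2.
exists f => [g x Gg|a b Aa Bb].
  (* Both [g x - x] and its opposite are negligible, so [f] is nonnegative on each and hence
     zero. *)
  have Nx := negligible_sub x Gg.
  have /= := fK _ (K0 _ Nx); have /= := fK _ (K0 _ (negligibleZ (-1) Nx)).
  by rewrite scaleN1r linearN linearB /=; lra.
have Kab : K (b - a, r).
  by exists 1, a, b, 0; rewrite scale1r addr0 mul1r; split => //; exact: negligible0.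
by have /= := fK _ Kab; rewrite linearB /=; lra.
Qed.

End Separation.

Lemma invariant_hyperplane (R : realType) (X : normedModType R)
    (G : set (bounded_op X)) (f : {scalar X}) (alpha : R) : op_group G ->
  (forall g x, G g -> f (g x) = f x) -> invariant_set G (hyperplane f alpha).
Proof.
move=> [_ _ GV] fG g Gg; apply/seteqP; split=> [_ [x fx <-]|x fx].
  by rewrite /hyperplane /= fG.
have [h Gh [gh _]] := GV g Gg; exists (h x); first by rewrite /hyperplane /= fG.
exact: (congr1 (fun k : bounded_op X => k x) gh).
Qed.

Theorem theorem8 (R : realType) (X : completeNormedModType R)
    (G : set (bounded_op X)) (A B : set X)
    (G_group : op_group G) (G_compact : compact G)
    (G_isometry : forall g, G g -> op_isometry g)
    (A_neq0 : A !=set0) (B_neq0 : B !=set0)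
    (A_convex : convex_set A) (B_convex : convex_set B)
    (A_invariant : invariant_set G A) (B_invariant : invariant_set G B)
    (A_closed : closed A) (B_compact : compact B)
    (AB_disjoint : A `&` B = set0) :
  exists (f : {scalar X}) (alpha : R),
    [/\ exists x : X, f x != 0,
        invariant_set G (hyperplane f alpha) &
        strictly_separates f alpha A B].
Proof.
have [r r0 rAB] := closed_compact_gap A_closed B_compact AB_disjoint.
have [f fG fAB] := invariant_separation G_group G_compact G_isometry
  A_neq0 B_neq0 A_convex B_convex A_invariant B_invariant rAB.
have [[a Aa] [b Bb]] := (A_neq0, B_neq0).
(* The values of [f] on [B] lie at least [r] above its supremum on [A]; [alpha] is the midpoint of
   this gap. *)
exists f, (sup (f @` A) + r / 2); split.
- exists (b - a); rewrite linearB /= gt_eqF//.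
  by have := fAB _ _ Aa Bb; lra.
- exact: invariant_hyperplane.
exists (r / 2); first by rewrite divr_gt0.
split=> [x Ax|x Bx].
  rewrite addrK; apply: ub_le_sup; last by exists x.
  by exists (f b) => _ [y Ay <-]; have := fAB _ _ Ay Bb; lra.
rewrite -addrA -splitr -lerBrDr; apply: ge_sup; first by exists (f a), a.
by move=> _ [y Ay <-]; rewrite lerBrDr fAB.
Qed.
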